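(* Let $0<p<1$ be a constant and let $\alpha=\frac{1}{1-p}$. Then with high probability (probability tending to $1$ as $n\to\infty$), $G=G(n,p)$ satisfies the following: if $H$ is a subgraph of $G$ such that for any edge $e$ of $G$ missing from $H$, adding $e$ to $H$ creates a new triangle, then $H$ contains at least $n\log_{\alpha} n-6n\log_{\alpha}\log_{\alpha} n$ edges.
   Context: $G(n,p)$ denotes the Erdős–Rényi random graph on vertex set $[n]$ in which each pair of vertices is an edge independently with probability $p$. *)

(* Defs.v *)
From mathcomp Require Import all_boot all_order all_algebra.
From mathcomp Require Import reals exp.

Set Implicit Arguments.
Unset Strict Implicit.
Unset Printing Implicit Defensive.

Import Order.TTheory GRing.Theory Num.Theory.
Local Open Scope ring_scope.

(* A simple graph on the vertex set 'I_n is identified with its set of edges, *)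
(* i.e. with a subset of pairs n.                                             *)
Definition pairs (n : nat) : {set {set 'I_n}} :=
  [set e : {set 'I_n} | #|e| == 2%N].

(* The probability that G(n, p) is exactly the graph G. *)
Definition Gnp_pmf (R : realType) (n : nat) (p : R) (G : {set {set 'I_n}}) : R :=
  \prod_(e in pairs n) (if e \in G then p else 1 - p).

(* The probability that G(n, p) has the property A. *)
Definition Gnp_prob (R : realType) (n : nat) (p : R)
    (A : pred {set {set 'I_n}}) : R :=
  \sum_(G : {set {set 'I_n}} | (G \subset pairs n) && A G) Gnp_pmf p G.

Definition is_triangle (n : nat) (H : {set {set 'I_n}}) (T : {set 'I_n}) : bool :=
  (#|T| == 3%N) && [forall e in pairs n, (e \subset T) ==> (e \in H)].

Definition creates_triangle (n : nat) (H : {set {set 'I_n}}) (e : {set 'I_n})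
    : bool :=
  [exists T : {set 'I_n}, is_triangle (e |: H) T && ~~ is_triangle H T].

(* H need not be triangle-free. *)
Definition triangle_saturated_in (n : nat) (G H : {set {set 'I_n}}) : bool :=
  (H \subset G) && [forall e in G :\: H, creates_triangle H e].

Definition logb (R : realType) (a x : R) : R := ln x / ln a.

(* The edge indicators are independent Bernoulli(p); the case A = B = set0    *)
(* says that the total mass is 1.                                             *)
Lemma Gnp_prob_indep (R : realType) (n : nat) (p : R) (A B : {set {set 'I_n}}) :
  A \subset pairs n -> B \subset pairs n -> [disjoint A & B] ->
  Gnp_prob p (fun G => (A \subset G) && [disjoint B & G])
  = p ^+ #|A| * (1 - p) ^+ #|B|.
Proof.
move=> sA sB dAB.
pose F (e : {set 'I_n}) : R :=
  if e \in pairs n then (if e \in B then 0 else p) else 0.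
pose K (e : {set 'I_n}) : R :=
  if e \in pairs n then (if e \in A then 0 else 1 - p) else 1.
transitivity (\prod_e (F e + K e)); last first.
  rewrite -!prodr_const (big_mkcond (mem A)) (big_mkcond (mem B)) -big_split /=.
  apply: eq_bigr => e _; rewrite /F /K.
  case: (boolP (e \in A)) => eA.
    by rewrite (subsetP sA) // (disjointFr dAB eA) addr0 mulr1.
  case: (boolP (e \in B)) => eB; first by rewrite (subsetP sB) // add0r mul1r.
  by case: ifP => _; rewrite ?add0r ?mulr1 // addrC subrK.
rewrite bigA_distr /Gnp_prob big_mkcond; apply: eq_bigr => G _.
case: ifP => [/and3P[sG sAG dBG]|].
  rewrite /Gnp_pmf big_mkcond; apply: eq_bigr => e _; rewrite /F /K.
  case: (boolP (e \in G)) => eG.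
    by rewrite (subsetP sG) // (disjointFl dBG eG).
  case: ifP => // _; rewrite ifN //.
  by apply: contra eG; apply: (subsetP sAG).
move=> h; apply/esym/eqP; rewrite prodf_seq_eq0; apply/hasP.
have [sG|/subsetPn[e eG eP]] := boolP (G \subset pairs n); last first.
  by exists e; rewrite ?mem_index_enum //= eG /F (negPf eP) eqxx.
have [sAG|/subsetPn[e eA eG]] := boolP (A \subset G); last first.
  by exists e; rewrite ?mem_index_enum //= (negPf eG) /K (subsetP sA) // eA eqxx.
move: h; rewrite sG sAG /= => /pred0Pn[e /= /andP[eB eG]].
by exists e; rewrite ?mem_index_enum //= eG /F (subsetP sB) // eB eqxx.
Qed.

(* Main.v *)
Require Import Defs.
From mathcomp Require Import all_boot all_order all_algebra.
From mathcomp Require Import all_classical all_reals all_analysis.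
From mathcomp Require Import fintype finset zify ring lra.
Import Order.TTheory GRing.Theory Num.Theory numFieldNormedType.Exports.

Set Implicit Arguments.
Unset Strict Implicit.
Unset Printing Implicit Defensive.

(** Logarithms are to base alpha and [L := log n]. Call a vertex heavy if its
    H-degree exceeds [L^2]; fewer than [2n/L] vertices are heavy when
    [#|H| <= n L]. Let [v] be light and let [S] be the set of its heavy
    H-neighbours. A G-neighbour [u] of [v] that has no G-neighbour in [S] is
    either an H-neighbour of [v] or joined to [v] by an H-path through a light
    vertex, so there are at most [L^2 + L^4] such [u]. In G(n,p), however, if
    [#|S| < L - 5 log L], their number is a sum of about [n] independent
    indicators of mean at least [p L^5 / n]; its exponential moment and a union
    bound over [v] and [S] show that with high probability it always exceeds
    [L^2 + L^4]. Hence every light vertex has at least [L - 5 log L] heavy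
    H-neighbours, and summing over the light vertices gives the bound. *)

(** * Heavy vertices and degree counts in [H] *)

Definition nbr (n : nat) (H : {set {set 'I_n}}) (v : 'I_n) : {set 'I_n} :=
  [set u | [set u; v] \in H].

(** Leaving out [v |: S] makes all pairs [[set u; v]] and [[set u; w]] with [w] in [S] genuine and
    distinct, so for [v \notin S] the memberships of different [u] are independent. *)
Definition private_nbr (n : nat) (G : {set {set 'I_n}}) (v : 'I_n)
    (S : {set 'I_n}) : {set 'I_n} :=
  [set u in ~: (v |: S) |
    ([set u; v] \in G) && [forall w in S, [set u; w] \notin G]].

Definition heavy (n : nat) (H : {set {set 'I_n}}) (D : nat) : {set 'I_n} :=
  [set v | D < #|nbr H v|].

Lemma set2_injl (T : finType) (v : T) : injective (fun u => [set u; v]).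
Proof.
move=> u u' /setP e; have := e u; rewrite !inE eqxx /= => /esym/orP[/eqP//|/eqP uv].
by have := e u'; rewrite !inE uv eqxx orbb => /eqP.
Qed.

Lemma card_nbrI (n : nat) (H : {set {set 'I_n}}) (v : 'I_n) (A : {set 'I_n}) :
  #|nbr H v :&: A| <= #|[set e in H | (v \in e) && (e :&: A != set0)]|.
Proof.
rewrite -(card_imset (mem (nbr H v :&: A)) (@set2_injl _ v)).
apply/subset_leq_card/subsetP => _ /imsetP[u + ->].
rewrite !inE => /andP[-> uA]; rewrite eqxx orbT /=.
by apply/set0Pn; exists u; rewrite !inE eqxx.
Qed.

(** Double counting: an edge of [H] meeting [A] is counted once per endpoint in [B]. Used for the
    degrees of heavy vertices ([c = 2]) and for the edges between light and heavy vertices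
    ([c = 1]). *)
Lemma sum_nbrI (n : nat) (H : {set {set 'I_n}}) (A B : {set 'I_n}) (c : nat) :
  (forall e, e \in H -> e :&: A != set0 -> #|e :&: B| <= c) ->
  \sum_(v in B) #|nbr H v :&: A| <= c * #|H|.
Proof.
move=> ec.
apply: (@leq_trans (\sum_(v in B) \sum_(e in H) ((v \in e) && (e :&: A != set0)))).
  apply: leq_sum => v _; apply: leq_trans (card_nbrI _ _ _) _.
  rewrite -sum1_card big_mkcond /= [X in _ <= X]big_mkcond /=.
  apply: leq_sum => e _; rewrite !inE.
  by case: (e \in H); case: (v \in e); case: (_ != _).
rewrite exchange_big /= mulnC -sum_nat_const; apply: leq_sum => e eH.
have [eA|eA] := boolP (e :&: A != set0); last first.
  by rewrite big1 // => v _; rewrite andbF.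
apply: leq_trans (ec e eH eA); rewrite -sum1_card big_mkcond /=.
rewrite [X in _ <= X]big_mkcond /=; apply: leq_sum => v _.
by rewrite !inE andbT; case: (v \in B); case: (v \in e).
Qed.

Lemma heavy_card (n : nat) (H : {set {set 'I_n}}) (D : nat) :
  H \subset pairs n -> D.+1 * #|heavy H D| <= 2 * #|H|.
Proof.
move=> sH; apply: leq_trans (@sum_nbrI _ H setT (heavy H D) 2 _); last first.
  move=> e /(subsetP sH); rewrite inE => /eqP <- _.
  by apply/subset_leq_card/subsetIl.
rewrite mulnC -sum_nat_const; apply: leq_sum => v.
by rewrite inE setIT.
Qed.

Lemma light_heavy_edges (n : nat) (H : {set {set 'I_n}}) (A : {set 'I_n}) :
  H \subset pairs n -> \sum_(v in ~: A) #|nbr H v :&: A| <= #|H|.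
Proof.
move=> sH; rewrite -[X in _ <= X]mul1n; apply: sum_nbrI => e /(subsetP sH).
rewrite inE => /eqP e2; rewrite -card_gt0 => eA.
have := cardsID A e; rewrite e2 setDE; lia.
Qed.

(** * Consequences of saturation *)

(** A triangle of [[set u; v] |: H] missing [u] or [v] would already be a triangle of [H]. So the
    new one consists of [u], [v] and some [w], and its other two sides lie in [H]. *)
Lemma creates_triangle_nbr (n : nat) (H : {set {set 'I_n}}) (u v : 'I_n) :
  u != v -> creates_triangle H [set u; v] ->
  exists2 w, w \in nbr H v & u \in nbr H w.
Proof.
move=> uv /existsP[T /andP[/andP[T3 /forall_inP tT] nT]].
have eT : [set u; v] \subset T.
  apply: contraR nT => neT; rewrite /is_triangle T3; apply/forall_inP => f f2.
  apply/implyP => fT; have := implyP (tT f f2) fT.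
  by rewrite in_setU1 => /orP[/eqP fe|//]; rewrite -fe fT in neT.
have /cards1P[w Tw] : #|T :\: [set u; v]| == 1.
  by rewrite cardsD (setIidPr eT) (eqP T3) cards2 uv.
have : w \in T :\: [set u; v] by rewrite Tw set11.
rewrite !inE negb_or => /andP[/andP[wu wv] wT].
have Huv x y : x != y -> x \in T -> y \in T -> [set x; y] != [set u; v] ->
    [set x; y] \in H.
  move=> xy xT yT ne; have /implyP : ([set x; y] \subset T) ==>
      ([set x; y] \in [set u; v] |: H) by apply: tT; rewrite inE cards2 xy.
  rewrite subUset !sub1set xT yT => /(_ isT).
  by rewrite in_setU1 (negPf ne).
have uT : u \in T by rewrite (subsetP eT) // !inE eqxx.
have vT : v \in T by rewrite (subsetP eT) // !inE eqxx orbT.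
have wuv : w \notin [set u; v] by rewrite !inE negb_or wu.
exists w; rewrite inE; apply: Huv => //; rewrite 1?eq_sym //.
  by apply: contraNneq wuv => ->; rewrite !inE eqxx.
by apply: contraNneq wuv => ->; rewrite !inE eqxx orbT.
Qed.

Lemma private_nbr_heavy (n : nat) (G H : {set {set 'I_n}}) (D : nat) (v : 'I_n) :
  triangle_saturated_in G H -> v \notin heavy H D ->
  #|private_nbr G v (nbr H v :&: heavy H D)| <= D + D * D.
Proof.
move=> /andP[sHG /forall_inP satH] vA; set S := _ :&: _.
have degB w : w \notin heavy H D -> #|nbr H w| <= D by rewrite inE -leqNgt.
(* [C] collects the ends of [H]-paths from [v] whose middle vertex is light. *)
set C := \bigcup_(w in nbr H v :\: heavy H D) nbr H w.
have cC : #|C| <= D * D.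
  apply: (@leq_trans (\sum_(w in nbr H v :\: heavy H D) #|nbr H w|)).
    rewrite /C; elim/big_ind2: _ => [|X x Y y hx hy|//]; first by rewrite cards0.
    by apply: leq_trans (leq_card_setU _ _) (leq_add _ _).
  apply: (@leq_trans (#|nbr H v :\: heavy H D| * D)).
    rewrite -sum_nat_const; apply: leq_sum => w; rewrite in_setD => /andP[wA _].
    exact: degB.
  rewrite leq_mul2r; apply/orP; right.
  by apply: leq_trans (degB v vA); apply/subset_leq_card/subsetDl.
apply: (@leq_trans #|nbr H v :|: C|); last first.
  by apply: leq_trans (leq_card_setU _ _) (leq_add _ cC); apply: degB.
apply/subset_leq_card/subsetP => u; rewrite inE in_setC in_setU1 negb_or.
move=> /and3P[/andP[uv uS] uvG /forall_inP nS].
rewrite in_setU; apply/orP; have [uvH|uvH] := boolP ([set u; v] \in H).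
  by left; rewrite inE.
right; have eD : [set u; v] \in G :\: H by rewrite in_setD uvH.
have [w wv uw] := creates_triangle_nbr uv (satH _ eD).
apply/bigcupP; exists w => //; rewrite in_setD wv andbT.
(* A heavy [w] would belong to [S], and the edge [[set u; w]] would contradict that [u] is
   private. *)
apply: contraTN uw => wA; rewrite inE; apply: contra (nS w _).
  exact: (subsetP sHG).
by rewrite in_setI wv.
Qed.

Local Open Scope ring_scope.

Lemma light_heavy_edges_ge (R : realType) (n : nat) (G H : {set {set 'I_n}})
    (D : nat) (x : R) :
  G \subset pairs n -> triangle_saturated_in G H ->
  (forall (v : 'I_n) (S : {set 'I_n}), v \notin S -> #|S|%:R < x ->
     (D + D * D < #|private_nbr G v S|)%N) ->
  #|~: heavy H D|%:R * x <= #|H|%:R.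
Proof.
move=> sG satH large; have sH : H \subset pairs n.
  by case/andP: satH => /subset_trans + _; apply.
apply: (@le_trans _ _
    (\sum_(v in ~: heavy H D) #|nbr H v :&: heavy H D|)%N%:R); last first.
  by rewrite ler_nat light_heavy_edges.
rewrite natr_sum mulrC mulr_natr -sumr_const; apply: ler_sum => v.
rewrite in_setC => vA; rewrite leNgt; apply/negP => dx.
(* [large] is applied to the set of heavy neighbours of [v], which omits [v] because [v] is
   light. *)
have := private_nbr_heavy satH vA; rewrite leqNgt large //.
by rewrite in_setI negb_and vA orbT.
Qed.

(** * Exponential moment of the number of private neighbours *)

Lemma prodrD1 (R : comPzRingType) (I : finType) (f : I -> R) :
  \prod_i (f i + 1) = \sum_(J : {set I}) \prod_(i in J) f i.
Proof. by rewrite bigA_distr; apply: eq_bigr => J _; rewrite [RHS]big_mkcond. Qed.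

Lemma Gnp_pmf_ge0 (R : realType) (n : nat) (p : R) (G : {set {set 'I_n}}) :
  0 <= p <= 1 -> 0 <= Gnp_pmf p G.
Proof.
by move=> /andP[p0 p1]; apply: prodr_ge0 => e _; case: ifP; rewrite ?subr_ge0.
Qed.

Lemma Gnp_private (R : realType) (n : nat) (p : R) (v : 'I_n) (S J : {set 'I_n}) :
  v \notin S -> J \subset ~: (v |: S) ->
  Gnp_prob p (fun G => [forall u in J,
    ([set u; v] \in G) && [forall w in S, [set u; w] \notin G]])
  = (p * (1 - p) ^+ #|S|) ^+ #|J|.
Proof.
move=> vS sJ.
have JU u : u \in J -> (u != v) /\ (u \notin S).
  by move/(subsetP sJ); rewrite in_setC in_setU1 negb_or => /andP.
(* [A] holds the pairs that must be edges, [B] those that must not be; [v \notin S] keeps them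
   disjoint. *)
pose A := [set [set u; v] | u in J].
pose B := [set [set x.1; x.2] | x in finset.setX J S].
have cA : #|A| = #|J| by rewrite card_imset //; apply: set2_injl.
have cB : #|B| = (#|J| * #|S|)%N.
  rewrite -cardsX card_in_imset // => -[u w] [u' w']; rewrite !in_setX /=.
  move=> /andP[uJ wS] /andP[u'J w'S] /setP e.
  have uu' : u = u'.
    have := e u; rewrite !inE eqxx /= => /esym/orP[/eqP//|/eqP uw'].
    by case: (JU _ uJ); rewrite uw' w'S.
  subst u'; congr pair; have := e w; rewrite !inE eqxx orbT => /esym/orP[|/eqP//].
  by move=> /eqP wu; case: (JU _ uJ); rewrite -wu wS.
have sA : A \subset pairs n.
  by apply/subsetP => _ /imsetP[u uJ ->]; rewrite inE cards2 (JU u uJ).1.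
have sB : B \subset pairs n.
  apply/subsetP => _ /imsetP[[u w] /setXP[/= uJ wS] ->].
  rewrite inE cards2; have [_ uS] := JU u uJ.
  by rewrite (_ : u != w) //; apply: contraNneq uS => ->.
have dAB : [disjoint A & B].
  apply/pred0P => e /=; apply/negP => /andP[/imsetP[u uJ ->]].
  move=> /imsetP[[u' w]]; rewrite in_setX /= => /andP[u'J wS] /setP e2.
  have := e2 v; rewrite !inE eqxx orbT => /esym/orP[/eqP vu'|/eqP vw].
    by have [] := JU _ u'J; rewrite vu' eqxx.
  by rewrite -vw (negPf vS) in wS.
rewrite exprMn -exprM mulnC -cB -cA -(Gnp_prob_indep p sA sB dAB).
apply: eq_bigl => G; congr andb; apply/forall_inP/andP.
  move=> h; split.
    by apply/subsetP => _ /imsetP[u uJ ->]; case/andP: (h u uJ).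
  apply/pred0P => e /=; apply/negP => /andP[/imsetP[[u w]]].
  rewrite in_setX /= => /andP[uJ wS] ->; case/andP: (h u uJ) => _.
  by move=> /forall_inP/(_ w wS)/negP.
move=> [/subsetP hA dB] u uJ; rewrite hA; last by apply/imsetP; exists u.
apply/forall_inP => w wS; rewrite (disjointFr dB) //.
by apply/imsetP; exists (u, w); rewrite // in_setX uJ.
Qed.

(* Expanding [2^-1 ^+ #|X| = \prod_(u in X) (1 - 2^-1)] over subsets reduces the
   exponential moment of [#|X|] to the probabilities of [Gnp_private]. *)
Lemma private_nbr_moment (R : realType) (n : nat) (p : R) (v : 'I_n)
    (S : {set 'I_n}) :
  v \notin S ->
  \sum_(G : {set {set 'I_n}} | G \subset pairs n)
    Gnp_pmf p G * 2^-1 ^+ #|private_nbr G v S|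
  = (1 - p * (1 - p) ^+ #|S| / 2) ^+ #|~: (v |: S)|.
Proof.
move=> vS; set U := ~: _; set q := p * _.
(* Factors 1 outside [U] turn the power into a product over all vertices, the form [prodrD1]
   expands. *)
transitivity (\prod_u ((if u \in U then - (q / 2) else 0) + 1)); last first.
  rewrite -prodr_const [RHS]big_mkcond; apply: eq_bigr => u _.
  by case: ifP; rewrite ?add0r // addrC.
pose ev (G : {set {set 'I_n}}) u :=
  ([set u; v] \in G) && [forall w in S, [set u; w] \notin G].
have -> : \sum_(G : {set {set 'I_n}} | G \subset pairs n)
    Gnp_pmf p G * 2^-1 ^+ #|private_nbr G v S| =
    \sum_(G : {set {set 'I_n}} | G \subset pairs n) \sum_(J : {set 'I_n})
    Gnp_pmf p G * \prod_(u in J) (if (u \in U) && ev G u then - 2^-1 else 0).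
  apply: eq_bigr => G _; rewrite -mulr_sumr -prodrD1; congr *%R.
  rewrite -prodr_const [LHS]big_mkcond; apply: eq_bigr => u _.
  rewrite [u \in private_nbr _ _ _]inE -/U -/(ev G u); case: ifP => _; lra.
rewrite exchange_big prodrD1; apply: eq_bigr => J _.
(* Sets [J] not inside [U] contribute 0 on both sides. *)
have [JU|/subsetPn[u uJ uU]] := boolP (J \subset U); last first.
  rewrite [RHS](bigD1 u) //= (negPf uU) mul0r big1 // => G _.
  by rewrite (bigD1 u) //= (negPf uU) mul0r mulr0.
transitivity ((- 2^-1) ^+ #|J| * Gnp_prob p (fun G => [forall u in J, ev G u])).
  rewrite /Gnp_prob mulr_sumr big_mkcondr; apply: eq_bigr => G _.
  case: ifPn => [/forall_inP h|/forall_inPn[u uJ nu]].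
    rewrite mulrC; congr (_ * _); rewrite -prodr_const; apply: eq_bigr => u uJ.
    by rewrite (subsetP JU) // h.
  by rewrite (bigD1 u) //= (negPf nu) andbF mul0r mulr0.
rewrite Gnp_private // -/q -exprMn -prodr_const; apply: eq_bigr => u uJ.
by rewrite (subsetP JU) //; lra.
Qed.

(** Markov's inequality: where the number [X] of private neighbours is at most [k], one has
    [1 <= 2 ^+ k * 2^-1 ^+ X]. *)
Lemma Gnp_private_le (R : realType) (n : nat) (p : R) (v : 'I_n) (S : {set 'I_n})
    (k : nat) :
  0 <= p <= 1 -> v \notin S ->
  Gnp_prob p (fun G => (#|private_nbr G v S| <= k)%N)
  <= 2 ^+ k * (1 - p * (1 - p) ^+ #|S| / 2) ^+ #|~: (v |: S)|.
Proof.
move=> p01 vS; rewrite -private_nbr_moment // mulr_sumr /Gnp_prob big_mkcondr.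
apply: ler_sum => G _; have pG := Gnp_pmf_ge0 G p01.
have h2 : 0 < 2^-1 :> R by rewrite invr_gt0.
case: ifPn => [Xk|_]; last by rewrite !mulr_ge0 // exprn_ge0 // ltW.
rewrite mulrCA ler_peMr // exprVn ler_pdivlMr ?exprn_gt0 // mul1r.
by rewrite ler_weXn2l // ler1n.
Qed.

(** * Union bound over vertices and small sets *)

Lemma Gnp_probC (R : realType) (n : nat) (p : R) (A : pred {set {set 'I_n}}) :
  Gnp_prob p A = 1 - Gnp_prob p (predC A).
Proof.
apply/eqP; rewrite eq_sym subr_eq; apply/eqP.
(* Empty sets make this the statement that the total mass is 1. *)
have := @Gnp_prob_indep R n p set0 set0.
rewrite !sub0set cards0 !expr0 mulr1 => <- //; last by rewrite -setI_eq0 set0I.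
rewrite /Gnp_prob [LHS](bigID A) /=; congr +%R; apply: eq_bigl => G.
  by rewrite sub0set -setI_eq0 set0I eqxx !andbT.
by rewrite sub0set -setI_eq0 set0I eqxx !andbT.
Qed.

Lemma Gnp_prob_le (R : realType) (n : nat) (p : R) (A B : pred {set {set 'I_n}}) :
  0 <= p <= 1 -> (forall G : {set {set 'I_n}}, G \subset pairs n -> A G -> B G) ->
  Gnp_prob p A <= Gnp_prob p B.
Proof.
move=> p01 AB; rewrite /Gnp_prob !big_mkcondr; apply: ler_sum => G sG.
by case: ifPn => [/AB->//|_]; case: ifP => // _; apply: Gnp_pmf_ge0.
Qed.

Lemma Gnp_prob_union (R : realType) (n : nat) (p : R) (I : finType)
    (P : pred I) (A : I -> pred {set {set 'I_n}}) :
  0 <= p <= 1 ->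
  Gnp_prob p (fun G => [exists i, P i && A i G]) <= \sum_(i | P i) Gnp_prob p (A i).
Proof.
move=> p01; rewrite /Gnp_prob; under [leRHS]eq_bigr do rewrite big_mkcondr.
rewrite exchange_big /= big_mkcondr; apply: ler_sum => G _.
have pG := Gnp_pmf_ge0 G p01.
have s0 (Q : pred I) : 0 <= \sum_(i | Q i) (if A i G then Gnp_pmf p G else 0).
  by apply: sumr_ge0 => i _; case: ifP.
case: ifPn => // /existsP[i /andP[Pi Ai]].
by rewrite (bigD1 i) //= Ai lerDl.
Qed.

(** Such a set can be read off from a map ['I_s -> option T] that lists its elements and pads with
    [None]. *)
Lemma card_small_sets (T : finType) (s : nat) :
  (#|[set S : {set T} | (#|S| <= s)%N]| <= #|T|.+1 ^ s)%N.
Proof.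
pose F (f : {ffun 'I_s -> option T}) := [set x | Some x \in codom f].
rewrite -[s in leqRHS]card_ord -card_option -card_ffun.
apply: leq_trans (leq_imset_card F _); apply/subset_leq_card/subsetP => S.
rewrite inE => Ss; apply/imsetP.
exists [ffun i : 'I_s => nth None (map Some (enum S)) i] => //.
apply/setP => x; rewrite inE; apply/idP/codomP.
  rewrite -mem_enum => xS.
  have lt : (index x (enum S) < s)%N.
    by apply: leq_trans Ss; rewrite cardE index_mem.
  exists (Ordinal lt); rewrite ffunE /= (nth_map x) ?index_mem //.
  by rewrite nth_index.
move=> [i]; rewrite ffunE; have [lt|ge] := ltnP i (size (enum S)).
  by rewrite (nth_map x) // => -[->]; rewrite -mem_enum mem_nth.
by rewrite nth_default // size_map.
Qed.

Lemma Gnp_prob_few_private (R : realType) (n : nat) (p : R) (s k : nat) :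
  0 <= p <= 1 ->
  Gnp_prob p (fun G => [exists x : 'I_n * {set 'I_n},
    ((x.1 \notin x.2) && (#|x.2| <= s)%N) && (#|private_nbr G x.1 x.2| <= k)%N])
  <= n%:R * n.+1%:R ^+ s
     * (2 ^+ k * (1 - p * (1 - p) ^+ s / 2) ^+ (n - s.+1)).
Proof.
move=> p01; have /andP[p0 p1] := p01.
set c := 2 ^+ k * _.
apply: (le_trans (@Gnp_prob_union _ _ _ _ _
  (fun x G => #|private_nbr G x.1 x.2| <= k)%N p01)).
have q01 (m : nat) : 0 <= p * (1 - p) ^+ m <= 1.
  rewrite mulr_ge0 ?exprn_ge0 ?subr_ge0 //=.
  by rewrite mulr_ile1 ?exprn_ge0 ?exprn_ile1 ?subr_ge0 // lerBlDr lerDl.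
have c0 : 0 <= c.
  by rewrite mulr_ge0 ?exprn_ge0 //; have := q01 s; lra.
apply: (@le_trans _ _ (\sum_(x : 'I_n * {set 'I_n} |
    (x.1 \notin x.2) && (#|x.2| <= s)%N) c)).
  apply: ler_sum => -[v S] /= /andP[vS Ss].
  apply: le_trans (Gnp_private_le k p01 vS) _.
  rewrite ler_wpM2l ?exprn_ge0 //.
  (* The case [#|S| = s] dominates: a smaller [S] leaves more candidates [u] and makes each likelier
     to be private. *)
  have cU : (n - s.+1 <= #|~: (v |: S)|)%N.
    by rewrite cardsCs setCK cardsU1 vS card_ord leq_sub2l.
  apply: (@le_trans _ _ ((1 - p * (1 - p) ^+ #|S| / 2) ^+ (n - s.+1))).
    by rewrite ler_wiXn2l //; have := q01 #|S|; lra.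
  apply: lerXn2r; rewrite ?nnegrE; [have := q01 #|S|; lra|have := q01 s; lra|].
  have : p * (1 - p) ^+ s <= p * (1 - p) ^+ #|S|.
    by rewrite ler_wpM2l // ler_wiXn2l ?subr_ge0 // lerBlDr lerDl.
  by lra.
rewrite sumr_const -[c *+ _]mulr_natl ler_wpM2r // -natrX -natrM ler_nat.
have := card_small_sets 'I_n s; rewrite card_ord => cS.
apply: leq_trans (leq_mul (leqnn n) cS).
rewrite -[X in (_ <= X * _)%N](card_ord n) -cardsT -cardsX.
apply/subset_leq_card/subsetP => -[v S] /andP[_ /= Ss].
by rewrite in_setX in_setT inE.
Qed.

(** * Real estimates *)

(** Here [a] and [b] count heavy and light vertices, [h] counts edges, and [l] is [log_alpha L].
    Unless [n * L <= h] already, [L * a <= 2 * n], so dropping the heavy vertices costs at most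
    [2 * n <= n * l], which turns 5 into 6. *)
Lemma edges_lower_bound (R : realFieldType) (a b h n L l : R) :
  0 <= a -> 0 <= b -> a + b = n -> 1 <= L -> 2 <= l ->
  L ^+ 2 * a <= 2 * h -> b * (L - 5 * l) <= h -> n * L - 6 * n * l <= h.
Proof.
move=> a0 b0 abn L1 l2 ah bh; have [nLh|hnL] := leP (n * L) h; first nra.
have aL : L * a <= 2 * n.
  have L0 : 0 < L by lra.
  rewrite -(ler_pM2l L0); nra.
have : 0 <= a * l by nra.
have : n * 2 <= n * l by nra.
nra.
Qed.

(* [l], [L] stand for [ln alpha] and [log_alpha n], so that [n = expR (l * L)],
   and the hypothesis on [q] says [(1 - p) ^+ s >= L ^+ 5 / n]. *)
Lemma union_bound_decay (R : realType) (p q l L : R) (n s k : nat) :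
  0 < p <= 1 -> 0 < l -> 1 <= L -> (1 < n)%N -> n%:R = expR (l * L) -> s%:R <= L ->
  2 * (L + 1) <= n%:R -> k%:R <= 2 * L ^+ 4 ->
  L ^+ 5 / n%:R <= q <= 1 -> 3 * l + 3 <= p * L / 4 ->
  n%:R * n.+1%:R ^+ s * (2 ^+ k * (1 - p * q / 2) ^+ (n - s.+1)) <= expR (- L).
Proof.
move=> /andP[p0 p1] l0 L1 n1 nE sL Ln kL /andP[qL q1] Lbig.
have n0 : 0 < n%:R :> R by rewrite ltr0n; lia.
have q0 : 0 <= q by apply: le_trans qL; rewrite divr_ge0 ?exprn_ge0 //; lra.
have pq0 : 0 <= p * q by nra.
have pq1 : p * q <= 1 by nra.
(* Uses [n + 1 <= n ^ 2 = expR (2 * (l * L))]. *)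
have h1 : n.+1%:R ^+ s <= expR (s%:R * (2 * (l * L))).
  rewrite expRM_natl; apply: lerXn2r; rewrite ?nnegrE ?ler0n ?expR_ge0 //.
  rewrite mulrDl mul1r expRD -nE -natrM ler_nat; nia.
have h2 : 2 ^+ k <= expR k%:R :> R.
  rewrite -[k%:R]mulr1 expRM_natl; apply: lerXn2r; rewrite ?nnegrE ?expR_ge0 //.
  by have := expR_ge1Dx (1 : R); lra.
have h3 : (1 - p * q / 2) ^+ (n - s.+1) <= expR (- ((n - s.+1)%:R * (p * q / 2))).
  rewrite -[X in expR X]mulrN expRM_natl.
  apply: lerXn2r; rewrite ?nnegrE ?expR_ge0 ?expR_ge1Dx //; lra.
have m2 : n%:R / 2 <= (n - s.+1)%:R :> R.
  have sn : (s.+1 <= n)%N by rewrite -(ler_nat R) -natr1; lra.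
  by rewrite natrB // -[s.+1%:R]natr1; lra.
apply: (@le_trans _ _ (expR (l * L + s%:R * (2 * (l * L))
    + (k%:R - (n - s.+1)%:R * (p * q / 2))))).
  rewrite !expRD -nE; apply: ler_pM.
  - by rewrite mulr_ge0 ?exprn_ge0.
  - by rewrite mulr_ge0 ?exprn_ge0 //; lra.
  - by rewrite ler_pM2l.
  by apply: ler_pM; rewrite ?exprn_ge0 //; lra.
rewrite ler_expR.
have e1 : s%:R * (2 * (l * L)) <= 2 * l * L ^+ 2.
  have : s%:R * (l * L) <= L * (l * L) by apply: ler_wpM2r => //; nra.
  by nra.
have e2 : p * L ^+ 5 / 4 <= (n - s.+1)%:R * (p * q / 2).
  apply: (@le_trans _ _ (n%:R / 2 * (p * q / 2))); last by rewrite ler_wpM2r //; lra.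
  move: qL; rewrite ler_pdivrMr // => qL; nra.
have e3 : (3 * l + 3) * L ^+ 4 <= p * L ^+ 5 / 4.
  have -> : p * L ^+ 5 / 4 = p * L / 4 * L ^+ 4 by ring.
  by rewrite ler_wpM2r // exprn_ge0; lra.
(* The positive terms of the exponent add up to at most [(3 * l + 2) * L ^+ 4], so a surplus of
   [L ^+ 4 >= L] remains on the negative side. *)
have L2 : L ^+ 2 <= L ^+ 4 by rewrite ler_weXn2l.
have L4 : L <= L ^+ 4 by rewrite -[leLHS]expr1 ler_weXn2l.
nra.
Qed.

Lemma log_estimates (R : realType) (p l : R) : 0 < p -> 0 < l ->
  exists2 L0 : R, 1 <= L0 & forall L, L0 <= L ->
    [/\ 2 * (L + 1) <= expR (l * L), 3 * l + 3 <= p * L / 4,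
        2 <= ln L / l & 5 * (ln L / l) <= L].
Proof.
move=> p0 l0.
have l8 : 0 < 8 / l ^+ 2 by rewrite divr_gt0 // exprn_gt0.
have lp : 0 < 4 * (3 * l + 3) / p by rewrite divr_gt0 //; lra.
(* After the 1, the summands serve the four estimates in order. The first and the last estimate rest
   on [expR t >= 1 + t ^ 2 / 2], with [t = l * L] and [t = ln L]. *)
exists (1 + 8 / l ^+ 2 + 4 * (3 * l + 3) / p + expR (2 * l) + expR (10 / l)).
  by have := expR_gt0 (2 * l); have := expR_gt0 (10 / l); lra.
move=> L L0; have e2 := expR_gt0 (2 * l); have e10 := expR_gt0 (10 / l).
have L1 : 1 <= L by lra.
have lnL : expR (ln L) = L by rewrite lnK // posrE; lra.
have ln2 : 2 * l <= ln L by rewrite -ler_expR lnL; lra.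
have ln10 : 10 / l <= ln L by rewrite -ler_expR lnL; lra.
split.
- have lL0 : 0 <= l * L by nra.
  have := expR_ge1Dxn 1 lL0; rewrite (_ : (2`!)%:R = 2) //.
  have : 8 / l ^+ 2 <= L by lra.
  rewrite ler_pdivrMr ?exprn_gt0 // => L8.
  have : L * 8 <= L * (L * l ^+ 2) by rewrite ler_pM2l //; lra.
  by rewrite exprMn; lra.
- have : 4 * (3 * l + 3) / p <= L by lra.
  by rewrite ler_pdivrMr //; lra.
- by rewrite ler_pdivlMr.
have t0 : 0 <= ln L by lra.
have := expR_ge1Dxn 1 t0; rewrite (_ : (2`!)%:R = 2) // lnL.
rewrite mulrA ler_pdivrMr // => h.
move: ln10; rewrite ler_pdivrMr // => ln10.
have : ln L * 10 <= ln L * (ln L * l) by rewrite ler_pM2l //; lra.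
nra.
Qed.

(** * Explicit error bound and passage to the limit *)

Lemma Gnp_saturated_edges_ge (R : realType) (p : R) : 0 < p -> p < 1 ->
  let alpha : R := 1 / (1 - p) in
  exists L0 : R, forall n : nat, L0 <= logb alpha n%:R ->
    1 - expR (- logb alpha n%:R) <=
    Gnp_prob p (fun G : {set {set 'I_n}} =>
       [forall H : {set {set 'I_n}},
          triangle_saturated_in G H ==>
          (n%:R * logb alpha n%:R - 6 * n%:R * logb alpha (logb alpha n%:R)
             <= #|H|%:R)]).
Proof.
move=> p0 p1 alpha; rewrite /logb; set l := ln alpha.
have lE : l = - ln (1 - p) by rewrite /l /alpha div1r lnV // posrE subr_gt0.
have l0 : 0 < l by rewrite lE oppr_gt0 ln_lt0 //; lra.
have [L0 L01 est] := log_estimates p0 l0; exists L0 => n.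
set L := ln n%:R / l => /[dup] L0L /est[nL Lbig lam2 lam5].
set lam := ln L / l in lam2 lam5 *.
have L1 : 1 <= L by lra.
have lnn : 0 < ln n%:R :> R.
  by apply: (lt_le_trans l0); rewrite -[leLHS]mul1r -ler_pdivlMr.
have n1 : (1 < n)%N.
  rewrite ltnNge; apply: contraTN lnn => n_le1.
  by rewrite -leNgt ln_le0 // lern1.
have n0 : 0 < n%:R :> R by rewrite ltr0n; lia.
have nE : n%:R = expR (l * L) by rewrite mulrC divfK ?lnK ?posrE // gt_eqF.
have LE : L = expR (ln L) by rewrite lnK ?posrE //; lra.
have lnLE : ln L = lam * l by rewrite divfK // gt_eqF.
clearbody L lam; set x := L - 5 * lam; have x0 : 0 <= x by rewrite /x; lra.
(* Rounding down is harmless: [#|S| < x] still gives [#|S| <= s], and [L ^+ 2 <= D.+1] suffices to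
   bound the number of heavy vertices. *)
pose s := Num.truncn x; pose D := Num.truncn (L ^+ 2).
have sx : s%:R <= x by rewrite -truncn_ge_nat.
have DL : D%:R <= L ^+ 2 by rewrite -truncn_ge_nat // exprn_ge0; lra.
have p01 : 0 <= p <= 1 by lra.
rewrite Gnp_probC lerD2l lerN2.
apply: (@le_trans _ _ (Gnp_prob p (fun G => [exists x : 'I_n * {set 'I_n},
    ((x.1 \notin x.2) && (#|x.2| <= s)%N) &&
    (#|private_nbr G x.1 x.2| <= D + D * D)%N]))); last first.
  apply: le_trans (Gnp_prob_few_private _ _ _ p01) _.
  apply: (union_bound_decay _ l0 L1 n1 nE _ _ _ _  Lbig); first lra.
  - by rewrite /x in sx; lra.
  - by rewrite nE.
  - have : D%:R * D%:R <= L ^+ 4 by rewrite (exprD L 2 2) ler_pM.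
    have : L ^+ 2 <= L ^+ 4 by rewrite ler_weXn2l.
    by rewrite natrD natrM; lra.
  (* Since [l * x = l * L - 5 * ln L], [(1 - p) ^+ s] is at least [L ^+ 5 / n]. The 5 in [x] thus
     gives one power more than the [L ^+ 4] that bounds [D + D * D] up to a factor 2. *)
  have pE : 1 - p = expR (- l) by rewrite lE opprK lnK // posrE subr_gt0.
  have q1 : (1 - p) ^+ s <= 1 by apply: exprn_ile1; lra.
  rewrite q1 andbT [in leLHS]LE.
  rewrite pE -!expRM_natl nE -expRN -expRD ler_expR lnLE.
  have : s%:R * l <= x * l by rewrite ler_pM2r.
  by rewrite /x; lra.
(* Failure lies in the event of a bad pair [(v, S)]: without such a pair, every saturated [H]
   satisfies the edge bound. *)
apply: Gnp_prob_le => // G sG /=; rewrite negb_forall => /existsP[H].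
rewrite negb_imply => /andP[satH]; rewrite -ltNge => Hsmall.
apply: contraLR Hsmall => /existsPn good; rewrite -leNgt.
have sH : H \subset pairs n.
  by case/andP: satH => /subset_trans + _; apply.
apply: (@edges_lower_bound _ #|heavy H D|%:R #|~: heavy H D|%:R) => //.
- by rewrite -natrD cardsC card_ord.
- have := heavy_card D sH; rewrite -(ler_nat R) !natrM; apply: le_trans.
  by rewrite ler_wpM2r // ltW // -truncn_le_nat.
apply: (light_heavy_edges_ge sG satH) => v S vS Sx.
have Ss : (#|S| <= s)%N by rewrite truncn_ge_nat // ltW.
by have := good (v, S); rewrite /= vS Ss -ltnNge.
Qed.

Local Open Scope classical_set_scope.

Theorem theorem2p2 (R : realType) (p : R) (p_gt0 : 0 < p) (p_lt1 : p < 1) :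
  let alpha : R := 1 / (1 - p) in
  (fun n : nat =>
     Gnp_prob p (fun G : {set {set 'I_n}} =>
       [forall H : {set {set 'I_n}},
          triangle_saturated_in G H ==>
          (n%:R * logb alpha n%:R - 6 * n%:R * logb alpha (logb alpha n%:R)
             <= #|H|%:R)])) @ \oo --> (1 : R).
Proof.
move=> alpha; have [L0 hL0] := Gnp_saturated_edges_ge p_gt0 p_lt1.
have l0 : 0 < ln alpha.
  by rewrite /alpha div1r lnV ?posrE ?subr_gt0 // oppr_gt0 ln_lt0 //; lra.
have p01 : 0 <= p <= 1 by lra.
apply/cvgrPdist_le => e e0; near=> n.
(* Past this threshold [log_alpha n] exceeds [L0], so the explicit bound applies, and exceeds
   [- ln e], so the error is at most [e]. *)
have : expR (ln alpha * Num.max L0 (- ln e)) <= n%:R.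
  by near: n; apply: nbhs_infty_ger.
move=> nbig; have n0 : 0 < n%:R :> R := lt_le_trans (expR_gt0 _) nbig.
have : Num.max L0 (- ln e) <= logb alpha n%:R.
  by rewrite ler_pdivlMr // mulrC -ler_expR lnK.
rewrite ge_max => /andP[/hL0 lower Le]; rewrite ger0_norm.
  have : expR (- logb alpha n%:R) <= e by rewrite -[leRHS]lnK // ler_expR; lra.
  by lra.
by rewrite Gnp_probC subr_ge0 lerBlDr lerDl sumr_ge0 // => G _; apply: Gnp_pmf_ge0.
Unshelve. all: by end_near.
Qed.
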